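(* Let $X\neq\{0\}$ be a complex Banach space with unit ball $B_X$, let $n\ge 1$ be an integer, and let $R\in(0,1)$ be the positive root of the equation $$3(1-r)\log\frac{1}{1-r}-2r=0 .$$ Let $a=(a_1,\dots,a_n)\in\overline{\mathbb{D}^n}$ and let $F:B_X\to\overline{\mathbb{D}^n}$ be a holomorphic mapping with $$F(z)=a+\sum_{s=1}^\infty P_s(z),\qquad z\in B_X,$$ where $P_s(z)=\frac{1}{s!}D^sF(0)(z^s)$. Assume that $|a_j|=\Vert a\Vert_\infty$ for all $j\in\{1,\dots,n\}$. Then $$\mathcal{C}_F(\Vert z\Vert):=\sum_{k=0}^\infty\frac{\Vert a\Vert_\infty\Vert z\Vert^k}{k+1}+\sum_{N=1}^\infty\frac{1}{N+1}\left(\sum_{k=1}^N\Vert z\Vert^{k-1}\,\Vert P_{N-k+1}(z)\Vert_\infty\right)\le\frac1r\log\frac1{1-r}$$ for all $z\in B_X$ with $\Vert z\Vert=r\le R$. The number $R$ cannot be improved, i.e. for every $R'\in(R,1)$ there exist a mapping $F$ satisfying all the hypotheses above (for the same $X$ and $n$) and a point $z\in B_X$ with $\Vert z\Vert=r\le R'$ for which the inequality fails.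
   Context: $\mathbb{D}=\{z\in\mathbb{C}:|z|<1\}$; $\mathbb{D}^n$ is the open unit polydisc in $\mathbb{C}^n$ and $\overline{\mathbb{D}^n}$ its closure. $\Vert w\Vert_\infty=\max_{1\le j\le n}|w_j|$ for $w\in\mathbb{C}^n$. $B_X=\{x\in X:\Vert x\Vert<1\}$. $D^sF(0)$ is the $s$-th Fréchet derivative of $F$ at $0$, a symmetric $s$-linear mapping $X^s\to\mathbb{C}^n$, and $D^sF(0)(z^s)$ means $D^sF(0)(z,\dots,z)$; thus $P_s$ is the $s$-homogeneous polynomial in the expansion of $F$ at the origin. The quantity $\mathcal{C}_F(\Vert z\Vert)$ (the majorant series associated with the Cesàro operator) depends on $z$, not only on $\Vert z\Vert$, despite the notation. At $r=0$ the right-hand side $\frac1r\log\frac1{1-r}$ is read as its limit $1$. *)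

(* Defs.v *)
From HB Require Import structures.
From mathcomp Require Import all_boot all_order all_algebra.
From mathcomp Require Import complex.
From mathcomp Require Import all_classical all_reals all_analysis.

Set Implicit Arguments.
Unset Strict Implicit.
Unset Printing Implicit Defensive.

Import Order.TTheory GRing.Theory Num.Theory.
Import numFieldNormedType.Exports.

Local Open Scope classical_set_scope.
Local Open Scope complex_scope.
Local Open Scope ring_scope.

(* The library attaches the topology of the norm to a variable of type
   [numFieldType]; these instances provide it on the concrete field [R[i]]. *)
HB.instance Definition _ (R : realType) :=
  PseudoPointedMetric.copy R[i] (R[i] : numFieldType)^o.
HB.instance Definition _ (R : realType) :=
  NormedModule.copy R[i] (R[i] : numFieldType)^o.

(* The norm of a normed space over [R[i]] takes its values in [R[i]] (they are
   nonnegative reals); [rnorm] is the same norm with values in [R].  On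
   ['rV[R[i]]_n] the library norm is the max norm, so that [rnorm w] is
   $\Vert w\Vert_\infty$ there. *)
Definition rnorm (R : realType) (V : normedModType R[i]) (x : V) : R :=
  complex.Re `|x|.

Definition unit_ball (R : realType) (X : normedModType R[i]) : set X :=
  [set z | `|z| < 1].
Arguments unit_ball {R} X.

Definition polydisc (R : realType) (n : nat) : set 'rV[R[i]]_n :=
  [set w | forall j, `|w ord0 j| < 1].

(* Complex Fréchet differentiability at every point of the open set [U]; the
   values of [F] outside [U] are irrelevant. *)
Definition holomorphic_on (R : realType) (X Y : normedModType R[i])
    (U : set X) (F : X -> Y) : Prop :=
  forall z, U z -> differentiable F z.

(* [frechet_deriv F [:: v1; ...; vs] x] is $D^sF(x)(v_1,\dots,v_s)$, through
   $D^sF(x)(v_1,\dots,v_s) = (D(D^{s-1}F)(x)\,v_1)(v_2,\dots,v_s)$, where the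
   evaluation at $(v_2,\dots,v_s)$, being linear and continuous, is performed
   before differentiating; this avoids normed spaces of multilinear maps. *)
Fixpoint frechet_deriv (R : realType) (X Y : normedModType R[i])
    (F : X -> Y) (vs : seq X) : X -> Y :=
  if vs is v :: vs' then fun x => 'd (frechet_deriv F vs') x v else F.

Definition taylor_term (R : realType) (X Y : normedModType R[i])
    (F : X -> Y) (s : nat) (z : X) : Y :=
  (s`!%:R : R[i])^-1 *: frechet_deriv F (nseq s z) 0.

Definition admissible (R : realType) (X : completeNormedModType R[i])
    (n : nat) (a : 'rV[R[i]]_n) (F : X -> 'rV[R[i]]_n) : Prop :=
  [/\ closure (@polydisc R n) a,
      holomorphic_on (unit_ball X) F,
      (forall z, unit_ball X z -> closure (@polydisc R n) (F z)),
      (forall z, unit_ball X z ->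
         (fun N => a + \sum_(1 <= s < N.+1) taylor_term F s z) @ \oo --> F z)
    & (forall j, `|a ord0 j| = `|a|)].

(* Both series have nonnegative terms; they are summed in [\bar R], so that an
   upper bound by a real number includes convergence. *)
Definition cesaro_majorant (R : realType) (X : completeNormedModType R[i])
    (n : nat) (a : 'rV[R[i]]_n) (F : X -> 'rV[R[i]]_n) (z : X) : \bar R :=
  (\sum_(0 <= k <oo) (rnorm a * rnorm z ^+ k / k.+1%:R)%:E +
   \sum_(1 <= N <oo)
     (N.+1%:R^-1 *
      \sum_(1 <= k < N.+1)
        rnorm z ^+ k.-1 * rnorm (taylor_term F (N - k + 1)%N z))%:E)%E.

(* $\frac1r\log\frac1{1-r}$, extended by its limit at $0$ *)
Definition cesaro_bound (R : realType) (r : R) : R :=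
  if r == 0 then 1 else r^-1 * ln ((1 - r)^-1).

(* Main.v *)
Require Import Defs.
From HB Require Import structures.
From mathcomp Require Import all_boot all_order all_algebra.
From mathcomp Require Import complex.
From mathcomp Require Import all_classical all_reals all_analysis.
From mathcomp Require Import ring lra.
From mathcomp Require cyclic separable cyclotomic.

Set Implicit Arguments.
Unset Strict Implicit.
Unset Printing Implicit Defensive.

Import Order.TTheory GRing.Theory Num.Theory.
Import numFieldNormedType.Exports.

Local Open Scope classical_set_scope.
Local Open Scope complex_scope.
Local Open Scope ring_scope.

(** With [r = rnorm z], [A = rnorm a], [L = cesaro_bound r] and
    [G = 1 / (1 - r)], the theorem is a comparison of [L] with [G].

    Upper bound.  Restrict the [j]-th component of [F] to the complex line
    through [z]: this is a power series in one variable, bounded by 1 on the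
    disc, with constant term [a_j] of modulus [A].  The coefficient estimate
    [|c_s| <= 1 - |c_0|^2] ([coef_bound]) then gives
    [|P_s(z)| <= (1 - A^2) r^s] ([taylor_term_bound]); the assumption that all
    the [|a_j|] agree is what turns the componentwise estimates into one for
    the max norm.  Since [sum r^k / (k+1) = L] and
    [sum_(N >= 1) N r^N / (N+1) = G - L], the majorant is at most
    [A L + (1 - A^2) (G - L)], and
    [L - A L - (1 - A^2) (G - L) = (1 - A) ((3 L - 2 G) + (1 - A) (G - L))],
    where [G - L >= 0].  So everything follows from [2 G <= 3 L], which is,
    for [r > 0], exactly [3 (1 - r) ln (1 / (1 - r)) - 2 r >= 0].  The quotient
    [(1 - r) ln (1 / (1 - r)) / r] is strictly decreasing, because the chord
    slopes of the concave function [ln] at 1 decrease; hence the inequality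
    holds up to the root [rho] and fails beyond it.

    The coefficient estimate is obtained without contour integrals: averaging
    [|(1 + y t^s) g(t)|^2] over the [M]-th roots of unity on a circle of radius
    [q < 1] and keeping only the coefficients of [1] and [t^s] gives
    [|c_0|^2 + |c_s q^s + c_0 y|^2 <= 1 + |y|^2] for all [y], and a good choice
    of [y] yields the claim.  The only facts about the Taylor terms that enter
    are their homogeneity ([taylor_termZ]) and the assumed convergence of the
    expansion.

    Sharpness.  Let [r > rho], so that [2 G > 3 L].  The Hahn-Banach theorem
    provides a linear functional [l] of norm at most 1 with [|l z| = |z| = r].
    Composing it with the disc automorphism [t |-> (b - t) / (1 - b t)],
    [0 < b < 1], in every coordinate gives an admissible map with
    [|P_s(z)| = (1 - b^2) b^(s-1) r^s].  Its majorant exceeds [b L] by at least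
    [(1 - b^2) b^M T], where [T] is the [M]-th partial sum of
    [sum N r^N / (N+1)].  For [M] large [2 T > L], and then for [b] close to 1
    one has [(1 + b) b^M T > L], that is [b L + (1 - b^2) b^M T > L]. *)

(** * Logarithmic sums and the critical radius *)

Section Log.
Variable R : realType.
Implicit Types r s : R.

Lemma geometric_small_real (k r d : R) : 0 <= k -> 0 <= r -> r < 1 -> 0 < d ->
  exists N, forall n, (N <= n)%N -> k * r ^+ n < d.
Proof.
move=> k0 r0 r1 d0.
have : geometric k r @ \oo --> (0 : R) by apply: cvg_geometric;
  rewrite ger0_norm.
move=> /cvgrPdist_lt /(_ d d0) [N _ HN]; exists N => n /HN /=.
by rewrite sub0r normrN ger0_norm ?mulr_ge0 ?exprn_ge0.
Qed.

Definition log_psum (n : nat) r : R := \sum_(k < n) r ^+ k / k.+1%:R.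

Lemma geometric_sum (n : nat) r : r != 1 ->
  \sum_(k < n) r ^+ k = (1 - r ^+ n) / (1 - r).
Proof.
move=> r1; have r1' : 1 - r != 0 by rewrite subr_eq0 eq_sym.
apply: (mulIf r1'); rewrite divfK// mulrC.
by rewrite -(opprB r 1) mulNr -subrX1 opprB.
Qed.

Lemma log_remainder_derive (n : nat) (x : R) : x < 1 ->
  is_derive x 1 (fun y => - ln (1 - y) - \sum_(k < n) k.+1%:R^-1 *: y ^+ k.+1)
    (x ^+ n / (1 - x)).
Proof.
move=> x1; have x1' : 0 < 1 - x by rewrite subr_gt0.
have dln : is_derive x 1 (fun y => ln (1 - y)) (- (1 - x)^-1).
  have dB : is_derive x 1 (fun y : R => 1 - y) (- 1).
    by apply: is_derive_eq; rewrite add0r mul1r.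
  by have := @is_derive1_comp _ _ (fun y : R => 1 - y) _ _ _ (is_derive1_ln x1')
    dB; rewrite mulrN1.
have dsum : is_derive x 1 (fun y => \sum_(k < n) k.+1%:R^-1 *: y ^+ k.+1)
    (\sum_(k < n) x ^+ k).
  have -> : (fun y => \sum_(k < n) k.+1%:R^-1 *: y ^+ k.+1) =
     \sum_(k < n) (k.+1%:R^-1 *: ((id : R -> R) ^+ k.+1)).
    by apply/funext => y; rewrite fct_sumE; apply: eq_bigr => k _;
      rewrite !fctE.
  apply: is_derive_eq.
  apply: eq_bigr => k _; rewrite /= /GRing.scale /=.
  by field.
have := is_deriveB (is_deriveN dln) dsum.
rewrite opprK geometric_sum ?lt_eqF//.
have -> // : (1 - x)^-1 - (1 - x ^+ n) / (1 - x) = x ^+ n / (1 - x).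
by field; exact: lt0r_neq0.
Qed.

(** The error vanishes at 0 and has derivative [x ^+ n / (1 - x)], which is
    nonnegative and increasing, so the mean value theorem gives both bounds. *)
Lemma log_remainder (n : nat) (x : R) : 0 <= x -> x < 1 ->
  0 <= - ln (1 - x) - x * log_psum n x <= x * (x ^+ n / (1 - x)).
Proof.
move=> x0 x1.
pose f := (fun y : R => - ln (1 - y) - \sum_(k < n) k.+1%:R^-1 *: y ^+ k.+1).
have fder (y : R) : y < 1 -> is_derive y 1 f (y ^+ n / (1 - y))
  by exact: log_remainder_derive.
have [c] : exists2 c : R, c \in `[0, x] & f x - f 0 =
  c ^+ n / (1 - c) * (x - 0).
  apply: (@MVT_segment R f (fun y : R => y ^+ n / (1 - y)) 0 x x0).
    by move=> y /itvP yi; apply: fder; apply: lt_trans x1; rewrite yi.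
  apply: derivable_within_continuous => y /itvP yi.
  by apply: ex_derive; apply: fder; apply: le_lt_trans x1; rewrite yi.
move=> /itvP ci; have f0 : f 0 = 0.
  rewrite /f subr0 ln1 oppr0 sub0r big1 ?oppr0// => k _.
  by rewrite expr0n scaler0.
rewrite f0 !subr0.
have -> : f x = - ln (1 - x) - x * log_psum n x.
  rewrite /f /log_psum mulr_sumr; congr (_ - _); apply: eq_bigr => k _.
  by rewrite exprS /GRing.scale /=; field.
move=> ->; have c0 : 0 <= c by rewrite ci.
have cx : c <= x by rewrite ci.
have c1 : 0 < 1 - c by rewrite subr_gt0 (le_lt_trans cx).
apply/andP; split.
  by rewrite mulr_ge0// divr_ge0 ?exprn_ge0// ltW.
rewrite [leRHS]mulrC ler_wpM2r//; apply: ler_pM.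
- exact: exprn_ge0.
- by rewrite invr_ge0 ltW.
- by rewrite lerXn2r// nnegrE.
- by rewrite lef_pV2 ?posrE; lra.
Qed.

(** [log_remainder] divided by [r]; the value 1 of [cesaro_bound] at 0 is the
    one for which the bounds persist there. *)
Lemma cesaro_bound_psum (n : nat) r : 0 <= r -> r < 1 ->
  0 <= cesaro_bound r - log_psum n r <= r ^+ n / (1 - r).
Proof.
move=> r0 r1; rewrite /cesaro_bound; case: eqVneq => [->|rn0].
  case: n => [|n]; first
    by rewrite /log_psum big_ord0 expr0 !subr0 divr1 ler01 lexx.
  rewrite /log_psum big_ord_recl /= expr0 divr1 big1; last first.
    by move=> i _; rewrite expr0n mul0r.
  by rewrite addr0 subrr expr0n mul0r lexx.
have rp : 0 < r by rewrite lt_def rn0.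
have := log_remainder n r0 r1.
rewrite lnV ?posrE ?subr_gt0//.
have -> : - ln (1 - r) - r * log_psum n r =
  r * (r^-1 * - ln (1 - r) - log_psum n r).
  by rewrite mulrBr mulVKf.
by rewrite pmulr_rge0// ler_pM2l.
Qed.

(** By strict concavity the tangent of [ln] at [y1] lies above [ln] at [y2] and
    is flatter than the chord from 1 to [y1]. *)
Lemma ln_chord (y1 y2 : R) : 1 < y1 -> y1 < y2 ->
  ln y2 * (y1 - 1) < ln y1 * (y2 - 1).
Proof.
move=> y11 y12.
have lnlt (t : R) : 0 < t -> t != 1 -> ln t < t - 1.
  move=> t0 t1; have l0 : ln t != 0 by rewrite ln_eq0.
  by have := expR_gt1Dx l0; rewrite lnK// -ltrBrDl.
have y10 : 0 < y1 by exact: lt_trans y11.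
have y20 : 0 < y2 by exact: lt_trans y12.
have := lnlt (y2 / y1) (divr_gt0 y20 y10) _.
rewrite ln_div ?posrE// => /(_ _)/wrap[].
  by rewrite gt_eqF// ltr_pdivlMr// mul1r.
have := lnlt y1^-1 _ _.
rewrite lnV ?posrE// invr_gt0 y10 invr_eq1 gt_eqF// => /(_ isT isT) h1 h2.
have h1' : y1 - 1 < y1 * ln y1.
  by move: h1; rewrite -(ltr_pM2l y10) mulrN mulrBr mulfV ?gt_eqF// mulr1; lra.
have h2' : (ln y2 - ln y1) * y1 < y2 - y1.
  by move: h2; rewrite -(ltr_pM2r y10) [ltRHS]mulrBl divfK ?gt_eqF// mul1r.
nra.
Qed.

Lemma log_ratio_decreasing r s : 0 < r -> r < s -> s < 1 ->
  ln (1 - s)^-1 * (r / (1 - r)) < ln (1 - r)^-1 * (s / (1 - s)).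
Proof.
move=> r0 rs s1; have r1 := lt_trans rs s1.
have shift (t : R) : t < 1 -> t / (1 - t) = (1 - t)^-1 - 1.
  by move=> t1; field; rewrite subr_eq0 gt_eqF.
rewrite !shift//; apply: ln_chord.
  by rewrite invf_gt1; lra.
by rewrite ltf_pV2 ?posrE; lra.
Qed.

Section CriticalRadius.
Variables (rho : R).
Hypotheses (rho_gt0 : 0 < rho) (rho_lt1 : rho < 1).
Hypothesis rho_root : 3 * (1 - rho) * ln ((1 - rho)^-1) - 2 * rho = 0.

Let ln_rho : ln (1 - rho)^-1 = 2 / 3 * (rho / (1 - rho)).
Proof.
have d : 1 - rho != 0 by rewrite subr_eq0 gt_eqF.
have d3 : 3 * (1 - rho) != 0 by rewrite mulf_neq0.
apply: (mulfI d3); move/eqP: rho_root; rewrite subr_eq0 => /eqP ->.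
by field.
Qed.

Lemma critical_radius_below r : 0 <= r -> r <= rho ->
  2 / (1 - r) <= 3 * cesaro_bound r.
Proof.
move=> r0 rrho; rewrite /cesaro_bound; case: eqVneq => [->|rn0].
  by rewrite subr0 divr1 mulr1 ler_nat.
have {r0 rn0} r0 : 0 < r by rewrite lt_def rn0.
have d0 : 0 < 1 - r by rewrite subr_gt0 (le_lt_trans rrho).
have k0 : 0 < rho / (1 - rho) by rewrite divr_gt0// subr_gt0.
suff : 2 / 3 * (r / (1 - r)) <= ln (1 - r)^-1.
  rewrite -(@ler_pM2l _ (3 / r)) ?divr_gt0//.
  rewrite [X in X <= _ -> _](_ : _ = 2 / (1 - r)); last by field;
    rewrite !gt_eqF.
  by rewrite mulrA.
move: rrho; rewrite le_eqVlt => /predU1P[->|rrho]; first by rewrite ln_rho.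
rewrite -(ler_pM2r k0) ltW//.
have := log_ratio_decreasing r0 rrho rho_lt1.
by rewrite ln_rho mulrAC.
Qed.

Lemma critical_radius_above r : rho < r -> r < 1 ->
  3 * cesaro_bound r < 2 / (1 - r).
Proof.
move=> rhor r1; have r0 := lt_trans rho_gt0 rhor.
rewrite /cesaro_bound gt_eqF//.
have d0 : 0 < 1 - r by rewrite subr_gt0.
have k0 : 0 < rho / (1 - rho) by rewrite divr_gt0// subr_gt0.
suff : ln (1 - r)^-1 < 2 / 3 * (r / (1 - r)).
  rewrite -(@ltr_pM2l _ (3 / r)) ?divr_gt0//.
  rewrite [X in _ < X -> _](_ : _ = 2 / (1 - r)); last by field;
    rewrite !gt_eqF.
  by rewrite mulrA.
rewrite -(ltr_pM2r k0).
have := log_ratio_decreasing rho_gt0 rhor r1.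
by rewrite ln_rho mulrAC.
Qed.

End CriticalRadius.

Definition cesaro_psum (n : nat) r : R :=
  \sum_(1 <= k < n) k%:R * r ^+ k / k.+1%:R.

(** Because [k / (k+1) = 1 - 1 / (k+1)], the sum splits into a geometric and a
    logarithmic one. *)
Lemma cesaro_psumE n r : r < 1 ->
  cesaro_psum n.+1 r = (1 - r ^+ n.+1) / (1 - r) - log_psum n.+1 r.
Proof.
move=> r1; rewrite -geometric_sum ?lt_eqF// /log_psum -sumrB big_ord_recl /=.
rewrite expr0 divr1 subrr add0r /cesaro_psum big_add1 /= big_mkord.
by apply: eq_bigr => k _; rewrite /bump /= add1n; field.
Qed.

Lemma cesaro_psum_bounds n r : 0 <= r -> r < 1 ->
  (1 - r ^+ n.+1) / (1 - r) - cesaro_bound r <= cesaro_psum n.+1 r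
    <= (1 - r)^-1 - cesaro_bound r.
Proof.
move=> r0 r1; have /andP[h1 h2] := cesaro_bound_psum n.+1 r0 r1.
rewrite cesaro_psumE// mulrBl mul1r in h2 *; apply/andP; split; lra.
Qed.

End Log.

(** * Coefficients of a power series bounded by one on the disc *)

Section Bessel.
Variable C : numClosedFieldType.

Lemma exists_prim_root (n : nat) : (0 < n)%N ->
  exists z : C, n.-primitive_root z.
Proof.
move=> n0; have [r Dp] := closed_field_poly_normal ('X^n - 1 : {poly C}).
rewrite (monicP (monicXnsubC 1 n0)) scale1r in Dp.
suff /hasP[z _ zP] : has n.-primitive_root r by exists z.
apply: cyclic.has_prim_root => //.
- by apply/allP => z; rewrite -root_prod_XsubC -Dp.
- rewrite -separable.separable_prod_XsubC -Dp cyclotomic.separable_Xn_sub_1//.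
  by rewrite pnatr_eq0 -lt0n.
- by rewrite -ltnS -(size_prod_XsubC r id) -Dp size_XnsubC.
Qed.

Lemma prim_root_norm (n : nat) (z : C) : n.-primitive_root z -> `|z| = 1.
Proof.
move=> zP; have n0 := prim_order_gt0 zP.
apply/eqP; rewrite -(@pexpr_eq1 _ _ n)// -normrX (prim_expr_order zP).
by rewrite normr1.
Qed.

Lemma sum_unity_powers (n : nat) (z : C) : z ^+ n = 1 -> z != 1 ->
  \sum_(k < n) z ^+ k = 0.
Proof.
move=> zn z1; apply: (mulfI (x := z - 1)); first by rewrite subr_eq0.
by rewrite -subrX1 zn subrr mulr0.
Qed.

(** Expand the squares and sum over [k] first: the off-diagonal sums run over
    all powers of a nontrivial root of unity and vanish. *)
Lemma parseval (n : nat) (z : C) (h : nat -> C) : n.-primitive_root z ->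
  \sum_(k < n) `|\sum_(i < n) h i * (z ^+ k) ^+ i| ^+ 2 =
  n%:R * \sum_(i < n) `|h i| ^+ 2.
Proof.
move=> zP; have n0 := prim_order_gt0 zP.
have z1 := prim_root_norm zP.
have z0 : z != 0 by rewrite -normr_gt0 z1.
have zz : z^* = z^-1.
  by apply: (mulfI z0); rewrite -normCK z1 expr1n divff.
have E (k : 'I_n) : `|\sum_(i < n) h i * (z ^+ k) ^+ i| ^+ 2 =
    \sum_(i < n) \sum_(j < n) h i * (h j)^* * (z ^+ i / z ^+ j) ^+ k.
  rewrite normCK rmorph_sum mulr_suml; apply: eq_bigr => i _.
  rewrite mulr_sumr; apply: eq_bigr => j _.
  rewrite rmorphM !rmorphXn /= zz mulrACA; congr (_ * _).
  by rewrite -!exprVn exprMn -!exprM ![(k * _)%N]mulnC.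
rewrite (eq_bigr _ (fun k _ => E k)) exchange_big mulr_sumr; apply: eq_bigr =>
  i _.
rewrite exchange_big (bigD1 i)//= [X in _ + X]big1 ?addr0; last first.
  move=> j ji; rewrite -mulr_sumr sum_unity_powers ?mulr0//.
    by rewrite expr_div_n -!exprM ![(_ * n)%N]mulnC !exprM (prim_expr_order zP)
      !expr1n divr1.
  rewrite -subr_eq0 -[X in _ - X](@divff _ (z ^+ j)) ?expf_neq0//.
  rewrite -mulrBl mulf_neq0 ?invr_eq0 ?expf_neq0// subr_eq0.
  by rewrite (eq_prim_root_expr zP) !modn_small ?ltn_ord// eq_sym.
rewrite divff ?expf_neq0// -mulr_sumr.
under eq_bigr do rewrite expr1n.
by rewrite sumr_const card_ord -normCK mulrC.
Qed.

(** Apply [parseval] to the product of [1 + (y / q^s) t^s] with the polynomial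
    [sum_(i < N) c_i t^i] on the circle of radius [q], and to the first factor
    alone; of the coefficients of the product only those of [1] and [t^s] are
    kept. Taking [N + s] sample points makes the discrete averages exact. *)
Lemma bessel_two_terms (N s : nat) (c : nat -> C) (q B y : C) :
  0 < q -> (0 < s < N)%N ->
  (forall t : C, `|t| = q -> `|\sum_(i < N) c i * t ^+ i| <= B) ->
  `|c 0%N| ^+ 2 + `|c s * q ^+ s + c 0%N * y| ^+ 2 <= B ^+ 2 * (1 + `|y| ^+ 2).
Proof.
move=> q0 /andP[s0 sN] bnd; pose M := (N + s)%N.
have M0 : (0 < M)%N by rewrite addn_gt0 s0 orbT.
have [z zP] := exists_prim_root M0.
have qs0 : q ^+ s != 0 by rewrite expf_neq0// gt_eqF.
pose p : {poly C} := 1 + (y / q ^+ s) *: 'X^s.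
pose g : {poly C} := \poly_(i < N) c i.
have szp : (size p <= s.+1)%N.
  rewrite (leq_trans (size_polyD _ _))// geq_max size_poly1 ltnS leq0n /=.
  by rewrite (leq_trans (size_scale_leq _ _))// size_polyXn.
have szpM : (size p <= M)%N.
  by rewrite (leq_trans szp)// /M -addn1 addnC leq_add2r (leq_trans _ sN).
have szpg : (size (p * g)%R <= M)%N.
  rewrite (leq_trans (size_polyMleq _ _))//.
  rewrite -subn1 leq_subLR (leq_trans (leq_add szp (size_poly _ _)))//.
  by rewrite addSn add1n addnC.
have ev (f : {poly C}) (k : 'I_M) : (size f <= M)%N ->
    \sum_(i < M) (f`_i * q ^+ i) * (z ^+ k) ^+ i = f.[q * z ^+ k].
  move=> szf; rewrite (horner_coef_wide _ szf); apply: eq_bigr => i _.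
  by rewrite exprMn mulrA.
have Hpg := parseval (fun i => (p * g)`_i * q ^+ i) zP.
have Hp := parseval (fun i => p`_i * q ^+ i) zP.
have Mp : 0 < M%:R :> C by rewrite ltr0n.
have le : \sum_(i < M) `|(p * g)`_i * q ^+ i| ^+ 2 <=
          B ^+ 2 * \sum_(i < M) `|p`_i * q ^+ i| ^+ 2.
  rewrite -(ler_pM2l Mp) -Hpg mulrCA -Hp mulr_sumr; apply: ler_sum => k _.
  rewrite !ev// hornerM normrM exprMn mulrC ler_wpM2r ?exprn_ge0//.
  rewrite lerXn2r ?nnegrE//.
    apply: le_trans (bnd q _); first by [].
    by rewrite gtr0_norm.
  have := bnd (q * z ^+ k); rewrite normrM normrX (prim_root_norm zP)
    expr1n mulr1.
  rewrite gtr0_norm// => /(_ erefl).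
  by rewrite /g horner_poly.
have pE i : p`_i = (i == 0%N)%:R + y / q ^+ s * (i == s)%:R.
  by rewrite /p coefD coef1 coefZ coefXn.
have p0 : p`_0 = 1 by rewrite pE eqxx (ltn_eqF s0) mulr0 addr0.
have ps : p`_s = y / q ^+ s by rewrite pE eqxx (gtn_eqF s0) mulr1 add0r.
have pgE i : (p * g)`_i = g`_i + y / q ^+ s *
  (if (i < s)%N then 0 else g`_(i - s)).
  by rewrite /p mulrDl mul1r -scalerAl coefD coefZ coefXnM.
have pg0 : (p * g)`_0 = c 0%N.
  by rewrite pgE s0 mulr0 addr0 coef_poly (leq_ltn_trans _ sN).
have pgs : (p * g)`_s * q ^+ s = c s * q ^+ s + c 0%N * y.
  rewrite pgE ltnn subnn !coef_poly sN (leq_ltn_trans _ sN)// mulrDl.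
  by rewrite mulrAC divfK// [_ * y]mulrC.
have sM : (s < M)%N by rewrite /M (leq_trans sN)// leq_addr.
have two (f : nat -> C) : \sum_(i < M) `|f i| ^+ 2 =
    `|f 0%N| ^+ 2 + `|f s| ^+ 2 +
    \sum_(i < M | (i != 0%N :> nat) && (i != s :> nat)) `|f i| ^+ 2.
  rewrite (bigD1 (Ordinal M0))//= (bigD1 (Ordinal sM))/=; last first.
    by rewrite -val_eqE /= gtn_eqF.
  by rewrite addrA; congr (_ + _).
move: le; rewrite (two (fun i => (p * g)`_i * q ^+ i))
  (two (fun i => p`_i * q ^+ i)) expr0 !mulr1 p0 pg0 pgs ps divfK// normr1
  expr1n.
rewrite [X in B ^+ 2 * (_ + X)]big1 ?addr0; last first.
  move=> i /andP[i0 is_]; rewrite pE (negbTE i0) (negbTE is_).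
  by rewrite mulr0 addr0 mul0r normr0 expr0n.
apply: le_trans; rewrite lerDl; apply: sumr_ge0 => i _.
exact: exprn_ge0.
Qed.

(** The hypothesis says that the lower triangular Toeplitz matrix with diagonal
    [a] and subdiagonal entry [d] is a contraction. The optimal test vector is
    [y = d a^* / (1 - |a|^2)]; it needs [|a| < 1], and for [|a| = 1] already
    [y = 0] forces [d = 0]. *)
Lemma coef_bound_of_two_terms (a d : C) :
  (forall y : C, `|a| ^+ 2 + `|d + a * y| ^+ 2 <= 1 + `|y| ^+ 2) ->
  `|d| <= 1 - `|a| ^+ 2.
Proof.
move=> H; have := H 0; rewrite mulr0 addr0 normr0 expr0n addr0 => H0.
have a1 : `|a| ^+ 2 <= 1.
  by apply: le_trans H0; rewrite lerDl exprn_ge0.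
have u0 : 0 <= 1 - `|a| ^+ 2 by rewrite subr_ge0.
move: u0; rewrite le_eqVlt => /predU1P[u0|u0].
  rewrite -u0; suff h : `|d| ^+ 2 <= 0.
    have : `|d| ^+ 2 == 0 by rewrite eq_le h exprn_ge0.
    by rewrite expf_eq0 /= => /eqP ->.
  by move: H0; rewrite -subr_ge0 opprD addrA -u0 sub0r oppr_ge0.
set u := 1 - `|a| ^+ 2 in u0 *.
have un0 : u != 0 by rewrite gt_eqF.
have aE : `|a| ^+ 2 = 1 - u by rewrite /u opprB addrC subrK.
have := H (d * a^* / u).
have -> : d + a * (d * a^* / u) = d / u.
  have -> : a * (d * a^* / u) = (a * a^*) * d / u by field.
  by rewrite -normCK aE; field.
rewrite !normrM norm_conjC normfV (gtr0_norm u0) !exprMn aE.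
move=> h; have : `|d| ^+ 2 / u <= u.
  have -> : `|d| ^+ 2 / u =
      `|d| ^+ 2 / u ^+ 2 - `|d| ^+ 2 * (1 - u) / u ^+ 2 by field.
  rewrite exprVn in h.
  rewrite lerBlDr; move: h; rewrite -lerBrDl => /le_trans; apply.
  by rewrite le_eqVlt; apply/orP; left; apply/eqP; field.
by rewrite ler_pdivrMr// -expr2 ler_pXn2r ?nnegrE ?normr_ge0 ?(ltW u0).
Qed.

End Bessel.

Lemma bernoulli_ineq (C : numDomainType) (d : C) n : 0 <= d -> d <= 1 ->
  1 - n%:R * d <= (1 - d) ^+ n.
Proof.
move=> d0 d1; elim: n => [|n IH]; first by rewrite mul0r subr0 expr0.
rewrite exprS; apply: le_trans (ler_wpM2l _ IH); last by rewrite subr_ge0.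
rewrite -subr_ge0.
have -> : (1 - d) * (1 - n%:R * d) - (1 - n.+1%:R * d) = n%:R * d ^+ 2
  by rewrite -natr1; ring.
by rewrite mulr_ge0 ?ler0n// exprn_ge0.
Qed.

Section PowerSeries.
Variable C : numClosedFieldType.
(* An abstract closed field need not be archimedean. *)
Hypothesis geometric_small : forall K t e : C,
  0 <= K -> 0 <= t -> t < 1 -> 0 < e ->
  exists N, forall n, (N <= n)%N -> K * t ^+ n <= e.
Variables (c : nat -> C) (g : C -> C).
Hypothesis g_sum : forall t, `|t| < 1 -> forall e : C, 0 < e ->
  exists N, forall n, (N <= n)%N -> `|g t - \sum_(i < n) c i * t ^+ i| < e.
Hypothesis g_le1 : forall t, `|t| < 1 -> `|g t| <= 1.

(** The terms of a convergent series are bounded. *)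
Lemma coef_geometric_bound q : 0 < q -> q < 1 ->
  exists2 K, 0 <= K & forall i, `|c i| * q ^+ i <= K.
Proof.
move=> q0 q1.
have [|N HN] := g_sum (t := q) _ ltr01; first by rewrite gtr0_norm.
pose a i := `|c i| * q ^+ i.
have a0 i : 0 <= a i by rewrite mulr_ge0// exprn_ge0// ltW.
have s0 : 0 <= \sum_(i < N) a i by apply: sumr_ge0.
exists (2 + \sum_(i < N) a i) => [|i]; first by rewrite addr_ge0.
have [iN|Ni] := ltnP i N.
  rewrite (bigD1 (Ordinal iN))//= addrCA lerDl addr_ge0//.
  exact: sumr_ge0.
apply: (@le_trans _ _ 2); last by rewrite lerDl.
have -> : `|c i| * q ^+ i = `|(g q - \sum_(j < i) c j * q ^+ j) -
                           (g q - \sum_(j < i.+1) c j * q ^+ j)|.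
  rewrite -[q in LHS]gtr0_norm// -normrX -normrM; congr (`|_|).
  by rewrite big_ord_recr /=; ring.
rewrite (le_trans (ler_normB _ _))// -[2]/(1 + 1) lerD// ltW//; apply: HN => //.
exact: leqW.
Qed.

(** On a circle of radius [q < 1] the series converges uniformly: comparing
    with a radius [p] between [q] and 1, the tail after [N] terms is at most a
    constant times [(q / p)^N]. *)
Lemma partial_sum_bound q : 0 < q -> q < 1 ->
  exists K r, [/\ 0 <= K, 0 <= r, r < 1 & forall N (t : C), `|t| = q ->
    `|\sum_(i < N) c i * t ^+ i| <= 1 + K * r ^+ N].
Proof.
move=> q0 q1; pose p := (q + 1) / 2.
have p0 : 0 < p by rewrite divr_gt0// addr_gt0.
have qp : q < p by rewrite /p ltr_pdivlMr// mulr_natr mulr2n ltrD2l.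
have p1 : p < 1 by rewrite /p ltr_pdivrMr// mul1r -[2]/(1 + 1) ltrD2r.
have [K K0 HK] := coef_geometric_bound p0 p1.
pose r := q / p.
have r0 : 0 < r by rewrite divr_gt0.
have r1 : r < 1 by rewrite ltr_pdivrMr// mul1r.
have r1' : 0 < 1 - r by rewrite subr_gt0.
exists (1 + K / (1 - r)), r; split => //.
- by rewrite addr_ge0// divr_ge0// ltW.
- exact: ltW.
move=> N t tq; have t1 : `|t| < 1 by rewrite tq.
(* A precision of [r ^+ N] for [g t] is absorbed in the geometric error. *)
have [M HM] := g_sum t1 (exprn_gt0 N r0).
pose m := maxn M N.
have Nm : (N <= m)%N by exact: leq_maxr.
have -> : \sum_(i < N) c i * t ^+ i = g t - (g t - \sum_(i < m) c i * t ^+ i)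
     - \sum_(N <= i < m) c i * t ^+ i.
  rewrite -!(big_mkord xpredT (fun i => c i * t ^+ i)).
  by rewrite (big_cat_nat (n := N) (p := m))//=; ring.
rewrite mulrDl mul1r addrA.
apply: (le_trans (ler_normB _ _)); apply: lerD.
  apply: (le_trans (ler_normB _ _)); apply: lerD; first exact: g_le1.
  by rewrite ltW// HM// leq_maxl.
apply: (le_trans (ler_norm_sum _ _ _)).
have : \sum_(N <= i < m) `|c i * t ^+ i| <= \sum_(N <= i < m) K * r ^+ i.
  apply: ler_sum => i _; rewrite normrM normrX tq.
  have -> : q = p * r by rewrite /r mulrC divfK// gt_eqF.
  by rewrite exprMn mulrA ler_wpM2r// exprn_ge0// ltW.
move=> /le_trans; apply; rewrite -mulr_sumr -mulrA ler_wpM2l//.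
rewrite mulrC ler_pdivlMr//.
rewrite -{1}(add0n N) big_addn mulr_suml.
have -> : \sum_(0 <= i < m - N) r ^+ (i + N) * (1 - r) =
  r ^+ N * ((1 - r) * \sum_(i < m - N) r ^+ i).
  rewrite big_mkord !mulr_sumr; apply: eq_bigr => i _; rewrite exprD; ring.
rewrite -(opprB r 1) mulNr -subrX1 opprB ler_piMr ?(exprn_ge0 _ (ltW r0))//.
by rewrite gerBl exprn_ge0// ltW.
Qed.

Lemma coef_bound_interior q s : 0 < q -> q < 1 -> (0 < s)%N ->
  `|c s| * q ^+ s <= 1 - `|c 0%N| ^+ 2.
Proof.
move=> q0 q1 s0.
rewrite -[X in _ * X]gtr0_norm ?exprn_gt0// -normrM.
apply: coef_bound_of_two_terms => y.
have [K [r [K0 r0 r1 HK]]] := partial_sum_bound q0 q1.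
apply/ler_addgt0Pr => e e0.
set B := 1 + `|y| ^+ 2.
have B0 : 0 < B by rewrite ltr_wpDr ?exprn_ge0.
(* [(1 + d)^2 B <= B + 3 d B] for [d <= 1], and [3 d B <= e]. *)
pose d := e / (3 * B + e).
have d0 : 0 < d by rewrite divr_gt0// addr_gt0// mulr_gt0.
have d1 : d <= 1 by rewrite ler_pdivrMr ?mul1r ?lerDr ?mulr_ge0
  ?ltW// addr_gt0// mulr_gt0.
have [N HN] := geometric_small K0 r0 r1 d0.
pose M := maxn N s.+1.
have sM : (0 < s < M)%N by rewrite s0 /= leq_maxr.
have KM : 0 <= K * r ^+ M by rewrite mulr_ge0// exprn_ge0.
have := bessel_two_terms y q0 sM (fun t tq => HK M t tq).
move=> /le_trans; apply; rewrite -/B.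
have : (1 + K * r ^+ M) ^+ 2 <= (1 + d) ^+ 2.
  apply: lerXn2r; rewrite ?nnegrE.
  - by rewrite addr_ge0.
  - by rewrite addr_ge0// ltW.
  - by rewrite lerD2l HN// leq_maxl.
move=> h; apply: (@le_trans _ _ ((1 + d) ^+ 2 * B));
  first by rewrite ler_wpM2r// ltW.
have : (1 + d) ^+ 2 <= 1 + 3 * d.
  rewrite sqrrD expr1n mul1r -addrA lerD2l -subr_ge0.
  have -> : 3 * d - (d *+ 2 + d ^+ 2) = d * (1 - d) by ring.
  by rewrite mulr_ge0 ?subr_ge0// ltW.
move=> h2; apply: (@le_trans _ _ ((1 + 3 * d) * B));
  first by rewrite ler_wpM2r// ltW.
rewrite mulrDl mul1r lerD2l.
have -> : 3 * d * B = e * (3 * B / (3 * B + e)).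
  by rewrite /d; move: (_^-1) => D; ring.
rewrite ler_piMr ?(ltW e0)// ler_pdivrMr ?mul1r ?lerDl ?(ltW e0)//.
by rewrite addr_gt0// mulr_gt0.
Qed.

Lemma coef_bound s : (0 < s)%N -> `|c s| <= 1 - `|c 0%N| ^+ 2.
Proof.
move=> s0; apply/ler_addgt0Pr => e e0.
(* By the Bernoulli inequality the loss [|c s| (1 - (1 - d)^s)] is at most
   [|c s| s d <= e]. *)
pose d := e / (`|c s| * s%:R + 1 + e).
have k0 : 0 <= `|c s| * s%:R by rewrite mulr_ge0.
have D0 : 0 < `|c s| * s%:R + 1 + e by rewrite addr_gt0// ltr_wpDl.
have d0 : 0 < d by rewrite divr_gt0.
have d1 : d < 1 by rewrite ltr_pdivrMr// mul1r ltrDr ltr_wpDl.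
have q0 : 0 < 1 - d by rewrite subr_gt0.
have q1 : 1 - d < 1 by rewrite gtrBl.
have := coef_bound_interior q0 q1 s0.
have := ler_wpM2l (normr_ge0 (c s)) (bernoulli_ineq s (ltW d0) (ltW d1)).
move=> /le_trans h /h; rewrite mulrBr mulr1 lerBlDr => /le_trans; apply.
rewrite lerD2l mulrA /d mulrA ler_pdivrMr// mulrC ler_pM2l//.
by rewrite -addrA lerDl addr_ge0// ltW.
Qed.

End PowerSeries.

(** * Homogeneity of the Taylor terms *)

Section DiffScale.
Variables (K : numFieldType) (V W : normedModType K).
Implicit Type F : V -> W.

(** Where a differential does not exist, its value is by definition the default
    linear map 0. *)
Lemma diff_default F x : ~ differentiable F x -> 'd F x = \0 :> (V -> W).
Proof.
move=> ndF; rewrite /diff getPN // => df dfP; apply: ndF; apply/diffP.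
rewrite /diff.
exact: (@getI _ (fun df : {linear V -> W} => continuous df /\ forall y,
  F y = F (lim (nbhs x)) + df (y - lim (nbhs x)) +o_(y \near x)
          (y - lim (nbhs x))) df dfP).
Qed.

(** If [F] is not differentiable at [x], neither is [k *: F], and both sides
    are 0 by [diff_default]; thus a scalar moves through all the differentials
    in the recursion that defines [frechet_deriv]. *)
Lemma diff_scale F k x v : k != 0 -> 'd (fun y => k *: F y) x v = k *: 'd F x v.
Proof.
move=> k0; have [dF|ndF] := pselect (differentiable F x).
  by rewrite (diffZ k dF).
rewrite (diff_default ndF) scaler0 diff_default// => /(differentiableZ k^-1)
  dkF.
apply: ndF; suff -> : F = k^-1 *: (fun y => k *: F y) by [].
by apply/funext => y; rewrite !fctE scalerA mulVf// scale1r.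
Qed.

End DiffScale.

Section Homogeneity.
Variables (R : realType) (X Y : normedModType R[i]).

Lemma frechet_deriv_scale (F : X -> Y) (k : R[i]) (z : X) s : k != 0 ->
  frechet_deriv F (nseq s (k *: z)) =
    (fun x => k ^+ s *: frechet_deriv F (nseq s z) x).
Proof.
move=> k0; elim: s => [|s IH]; first by apply/funext => x;
  rewrite /= expr0 scale1r.
apply/funext => x.
change ('d (frechet_deriv F (nseq s (k *: z))) x (k *: z) =
  k ^+ s.+1 *: 'd (frechet_deriv F (nseq s z)) x z).
rewrite {}IH; move: (frechet_deriv F (nseq s z)) => G.
have ks0 : k ^+ s != 0 by exact: expf_neq0.
rewrite exprSr; move: (k ^+ s) ks0 => c c0.
have E := diff_scale G x (k *: z) c0.
apply: (etrans E).
rewrite -scalerA; congr (_ *: _).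
exact: linearZ.
Qed.

Lemma taylor_term0 (F : X -> Y) s : (0 < s)%N -> taylor_term F s 0 = 0.
Proof. by case: s => // s _; rewrite /taylor_term /= linear0 scaler0. Qed.

Lemma taylor_termZ (F : X -> Y) (k : R[i]) (z : X) s : (0 < s)%N ->
  taylor_term F s (k *: z) = k ^+ s *: taylor_term F s z.
Proof.
move=> s0; have [->|k0] := eqVneq k 0.
  by rewrite scale0r taylor_term0// expr0n eqn0Ngt s0 scale0r.
by rewrite /taylor_term frechet_deriv_scale// !scalerA mulrC.
Qed.

End Homogeneity.

(** * Norms *)

Section Rnorm.
Variables (R : realType) (V : normedModType R[i]).
Implicit Types x y : V.

Lemma rnormE x : `|x| = (rnorm x)%:C.
Proof. by rewrite /rnorm RRe_real// ger0_real. Qed.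

Lemma rnorm_ge0 x : 0 <= rnorm x.
Proof. by rewrite -ler0c -rnormE. Qed.

Lemma rnormD x y : rnorm (x + y) <= rnorm x + rnorm y.
Proof. by rewrite -lecR rmorphD /= -!rnormE ler_normD. Qed.

Lemma rnormZ (k : R[i]) x : rnorm (k *: x) = rnorm k * rnorm x.
Proof.
apply: complexI; rewrite rmorphM /= -!rnormE.
exact: normrZ.
Qed.

End Rnorm.

Section RnormC.
Variable R : realType.
Lemma rnormC (t : R) : rnorm t%:C = `|t|.
Proof. by rewrite /rnorm normc_def /= expr0n addr0 sqrtr_sqr. Qed.

End RnormC.

Section RowNorm.
Variables (K : numFieldType) (n : nat).
Implicit Type w : 'rV[K]_n.

Lemma row_entry_le w j : `|w ord0 j| <= `|w|.
Proof.
rewrite [leRHS]mx_normE -[leLHS]nngE num_le.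
exact: (le_bigmax _ (fun i : 'I_1 * 'I_n => `|w i.1 i.2|%:nng) (ord0, j)).
Qed.

Lemma row_norm_le w (B : K) : 0 <= B ->
  (forall j, `|w ord0 j| <= B) -> `|w| <= B.
Proof.
move=> B0 wB; have [w0|/mx_norm_neq0[[i j] /= E]] := eqVneq (mx_norm w) 0.
  by rewrite (_ : `|w| = 0).
by rewrite (_ : `|w| = `|w i j|)// ord1.
Qed.

End RowNorm.

(** * The upper bound *)

Section CauchyEstimate.
Variable R : realType.

Lemma complex_geometric_small (K t e : R[i]) :
  0 <= K -> 0 <= t -> t < 1 -> 0 < e ->
  exists N, forall n, (N <= n)%N -> K * t ^+ n <= e.
Proof.
move=> K0 t0 t1 e0.
have KE : K = (complex.Re K)%:C by rewrite RRe_real// ger0_real.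
have tE : t = (complex.Re t)%:C by rewrite RRe_real// ger0_real.
have eE : e = (complex.Re e)%:C by rewrite RRe_real// gtr0_real.
move: K0 t0 t1 e0; rewrite KE tE eE; move: (complex.Re K) (complex.Re t)
  (complex.Re e) => k r d.
rewrite !ler0c -[1]/(1%:C) -[0 < _]/(0%:C < _) !ltcR => k0 r0 r1 d0.
have [N HN] := geometric_small_real k0 r0 r1 d0; exists N => m /HN /ltW.
by rewrite -rmorphXn -rmorphM lecR.
Qed.

Lemma closure_polydisc_le1 n (w : 'rV[R[i]]_n) : closure (@polydisc R n) w ->
  forall j, `|w ord0 j| <= 1.
Proof.
move=> cw j; apply/ler_addgt0Pr => e e0.
have [v [Pv wv]] := cw _ (nbhsx_ballx w e e0).
have -> : w ord0 j = v ord0 j + (w ord0 j - v ord0 j) by rewrite addrC subrK.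
rewrite (le_trans (ler_normD _ _))// lerD//; first exact/ltW/Pv.
have := wv; rewrite -ball_normE /= => /ltW; apply: le_trans.
by have := row_entry_le (w - v) j; rewrite !mxE.
Qed.

Variables (X : completeNormedModType R[i]) (n : nat).
Variables (a : 'rV[R[i]]_n) (F : X -> 'rV[R[i]]_n).
Hypothesis (n_gt0 : (0 < n)%N) (Fadm : admissible a F).

(** The [j]-th coordinate of [t |-> F (t *: u)] is a power series in one
    variable whose coefficients are the [j]-th coordinates of the Taylor
    terms. *)
Lemma taylor_entry_bound (u : X) (j : 'I_n) s : `|u| = 1 -> (0 < s)%N ->
  `|taylor_term F s u ord0 j| <= 1 - `|a| ^+ 2.
Proof.
case: Fadm => ca _ Fcl Fcvg aj u1 s0.
pose c i := if i is 0%N then a ord0 j else taylor_term F i u ord0 j.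
have tu (t : R[i]) : `|t| < 1 -> unit_ball X (t *: u).
  by move=> t1; rewrite /unit_ball /= normrZ u1 mulr1.
have := @coef_bound _ complex_geometric_small c (fun t => F (t *: u) ord0 j)
  _ _ s s0.
rewrite {2}/c aj; case: (s) s0 => // m _; apply.
- move=> t t1 e e0; have /cvgrPdist_lt /(_ e e0) [N _ HN] := Fcvg _ (tu t t1).
  (* The expansion up to order [m'] consists of [m'.+1] coefficients. *)
  exists N.+1 => -[//|m'] /HN; apply: le_lt_trans.
  have -> : \sum_(i < m'.+1) c i * t ^+ i =
      (a + \sum_(1 <= i < m'.+1) taylor_term F i (t *: u)) ord0 j.
    rewrite mxE summxE big_ord_recl expr0 mulr1 big_add1 /= big_mkord.
    congr (_ + _); apply: eq_bigr => i _.
    by rewrite /= /bump leq0n add1n taylor_termZ// [RHS]mxE mulrC.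
  by have := row_entry_le (F (t *: u) - (a + \sum_(1 <= i < m'.+1)
    taylor_term F i (t *: u))) j; rewrite mxE [X in _ + X]mxE.
- move=> t t1; exact: (closure_polydisc_le1 (Fcl _ (tu t t1))).
Qed.

(** The estimate on the unit sphere is transported to [z] by homogeneity; it
    holds for the max norm because it is the same in every coordinate. *)
Lemma taylor_term_bound (z : X) s : (0 < s)%N ->
  rnorm (taylor_term F s z) <= (1 - rnorm a ^+ 2) * rnorm z ^+ s.
Proof.
move=> s0; have [->|z0] := eqVneq z 0.
  rewrite taylor_term0// /rnorm !normr0 /= expr0n eqn0Ngt s0 mulr0.
  exact: lexx.
have rz0 : rnorm z != 0.
  by apply: contra z0 => /eqP rz; rewrite -normr_eq0 rnormE rz.
pose u := (rnorm z)^-1%:C *: z.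
have zE : z = (rnorm z)%:C *: u.
  by rewrite /u scalerA -rmorphM /= mulfV// scale1r.
have u1 : `|u| = 1.
  by rewrite /u normrZ [`|z|]rnormE ger0_norm ?ler0c ?invr_ge0
    ?rnorm_ge0// -rmorphM /= mulVf.
have bound : rnorm (taylor_term F s u) <= 1 - rnorm a ^+ 2.
  rewrite -lecR -rnormE rmorphB rmorph1 rmorphXn /= -rnormE.
  have E := fun j => taylor_entry_bound j u1 s0.
  apply: row_norm_le => //.
  exact: le_trans (E (Ordinal n_gt0)).
rewrite [in leLHS]zE taylor_termZ// rnormZ -rmorphXn rnormC ger0_norm.
  by rewrite mulrC ler_wpM2r// exprn_ge0// rnorm_ge0.
by rewrite exprn_ge0// rnorm_ge0.
Qed.

End CauchyEstimate.

Section SeriesTools.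
Variable R : realType.

Lemma nneseries_le_psum (u : nat -> R) m (B : R) : (forall k, 0 <= u k) ->
  (forall n, \sum_(m <= k < n) u k <= B) ->
  (\sum_(m <= k <oo) (u k)%:E <= B%:E)%E.
Proof.
move=> u0 uB; apply: lime_le; first by apply: is_cvg_nneseries => k _ _;
  rewrite lee_fin.
by apply: nearW => n; rewrite sumEFin lee_fin.
Qed.

Lemma psum_le_nneseries (u : nat -> R) m n : (forall k, 0 <= u k) ->
  ((\sum_(m <= k < n) u k)%:E <= \sum_(m <= k <oo) (u k)%:E)%E.
Proof.
by move=> u0; rewrite -sumEFin; apply: nneseries_lim_ge => k _ _;
  rewrite lee_fin.
Qed.

End SeriesTools.

Section UpperBound.
Variables (R : realType) (X : completeNormedModType R[i]) (n : nat).
Hypothesis n_gt0 : (0 < n)%N.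
Variables (rho : R).
Hypotheses (rho_gt0 : 0 < rho) (rho_lt1 : rho < 1).
Hypothesis rho_root : 3 * (1 - rho) * ln ((1 - rho)^-1) - 2 * rho = 0.

(** Each inner sum consists of [N] terms that are at most [(1 - A^2) r^N]. *)
Lemma cesaro_majorant_le (a : 'rV[R[i]]_n) (F : X -> 'rV[R[i]]_n) (z : X) :
  admissible a F -> rnorm z <= rho ->
  (cesaro_majorant a F z <= (cesaro_bound (rnorm z))%:E)%E.
Proof.
move=> Fadm zrho; rewrite /cesaro_majorant.
have P_le := fun s (s0 : (0 < s)%N) => taylor_term_bound n_gt0 Fadm z s0.
have A0 := rnorm_ge0 a; have r0 := rnorm_ge0 z.
have a1 : 0 <= 1 - rnorm a ^+ 2.
  rewrite subr_ge0 expr_le1// -lecR -rnormE rmorph1.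
  case: Fadm => /closure_polydisc_le1 /(_ (Ordinal n_gt0)) a1 _ _ _ aj.
  by rewrite aj in a1.
move: (rnorm a) (rnorm z) A0 r0 a1 zrho P_le => A r A0 r0 a1 zrho P_le.
have r1 : r < 1 := le_lt_trans zrho rho_lt1.
set L := cesaro_bound r.
have first_le : (\sum_(0 <= k <oo) (A * r ^+ k / k.+1%:R)%:E <= (A * L)%:E)%E.
  apply: nneseries_le_psum => [k|m]; first by rewrite !mulr_ge0// exprn_ge0.
  have /andP[+ _] := cesaro_bound_psum m r0 r1.
  rewrite subr_ge0 => /(ler_wpM2l A0); apply: le_trans.
  by rewrite /log_psum mulr_sumr big_mkord; apply: ler_sum => k _;
    rewrite mulrA.
pose G := (1 - r)^-1.
have second_le : (\sum_(1 <= N <oo) (N.+1%:R^-1 * \sum_(1 <= k < N.+1)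
     r ^+ k.-1 * rnorm (taylor_term F (N - k + 1)%N z))%:E <=
     ((1 - A ^+ 2) * (G - L))%:E)%E.
  apply: nneseries_le_psum => [k|m].
    rewrite mulr_ge0// sumr_ge0// => i _.
    by rewrite mulr_ge0 ?exprn_ge0 ?rnorm_ge0.
  have inner N : N.+1%:R^-1 * (\sum_(1 <= k < N.+1)
      r ^+ k.-1 * rnorm (taylor_term F (N - k + 1)%N z)) <=
      (1 - A ^+ 2) * (N%:R * r ^+ N / N.+1%:R).
    rewrite [leRHS](_ : _ = N.+1%:R^-1 *
      (\sum_(1 <= k < N.+1) (1 - A ^+ 2) * r ^+ N)).
      rewrite ler_wpM2l// big_nat [leRHS]big_nat; apply: ler_sum =>
        k /andP[k1 kN].
      have := P_le (N - k + 1)%N; rewrite addn1 => /(_ isT) h.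
      rewrite (le_trans (ler_wpM2l _ h)) ?exprn_ge0// mulrCA -exprD.
      by rewrite addnS -addSn prednK// subnKC.
    by rewrite sumr_const_nat subn1 /=; ring.
  apply: (@le_trans _ _ ((1 - A ^+ 2) * cesaro_psum m r)).
    by rewrite /cesaro_psum mulr_sumr; apply: ler_sum => N _; exact: inner.
  rewrite ler_wpM2l//; case: m => [|m].
    have := cesaro_psum_bounds 0 r0 r1; rewrite /cesaro_psum !big_geq//.
    by case/andP.
  by have /andP[] := cesaro_psum_bounds m r0 r1.
apply: (le_trans (leeD first_le second_le)); rewrite -EFinD lee_fin.
have crit : 2 * G <= 3 * L :=
  critical_radius_below rho_gt0 rho_lt1 rho_root r0 zrho.
have GL : 0 <= G - L.
  by have /andP[_] := cesaro_bound_psum 0 r0 r1;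
    rewrite /log_psum big_ord0 subr0 expr0 mul1r subr_ge0.
have A1 : A <= 1 by rewrite -(@expr_le1 _ 2)// -subr_ge0.
rewrite -subr_ge0.
have -> : L - (A * L + (1 - A ^+ 2) * (G - L)) =
  (1 - A) * ((3 * L - 2 * G) + (1 - A) * (G - L)) by ring.
have A1' : 0 <= 1 - A by rewrite subr_ge0.
by apply: mulr_ge0 => //; apply: addr_ge0; [rewrite subr_ge0 | apply: mulr_ge0].
Qed.

End UpperBound.

(** * The Hahn-Banach theorem *)

Section HahnBanach.
Variables (R : realType) (V : lmodType R) (p : V -> R).
Hypothesis p_subadd : forall x y, p (x + y) <= p x + p y.
Hypothesis p_homog : forall t x, 0 <= t -> p (t *: x) = t * p x.

(** Partially defined linear functionals are encoded as their graphs, so that a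
    chain has its union as an upper bound; the graphs are functional because
    they are linear and lie below [p]. *)
Definition dominated_graph (G : set (V * R)) : Prop :=
  (forall a g h, G g -> G h -> G (a *: g.1 + h.1, a * g.2 + h.2)) /\
  (forall g, G g -> g.2 <= p g.1).

Let p0 : p 0 = 0.
Proof. by rewrite -(scale0r 0) p_homog// mul0r. Qed.

(** The admissible values [c] at [x0] lie between all the numbers
    [g.2 - p (g.1 - x0)] and all the numbers [p (h.1 + x0) - h.2], and
    subadditivity puts the former below the latter. *)
Lemma dominated_graph_extend (G : set (V * R)) (x0 : V) :
  dominated_graph G -> G !=set0 ->
  exists c, dominated_graph
    [set q | exists g t, G g /\ q = (g.1 + t *: x0, g.2 + t * c)].
Proof.
move=> [Glin Gp] [g0 Gg0].
pose S := [set g.2 - p (g.1 - x0) | g in G].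
have SleU g h : G g -> G h -> g.2 - p (g.1 - x0) <= p (h.1 + x0) - h.2.
  move=> Gg Gh; have := Gp _ (Glin 1 g h Gg Gh); rewrite /= scale1r mul1r.
  have := p_subadd (g.1 - x0) (h.1 + x0).
  rewrite addrACA addNr addr0; lra.
have Ssup : has_sup S.
  split; first by exists (g0.2 - p (g0.1 - x0)), g0.
  by exists (p (g0.1 + x0) - g0.2) => _ [g Gg <-]; exact: SleU.
exists (sup S); split.
  move=> a _ _ [g [t [Gg ->]]] [h [s [Gh ->]]] /=.
  exists (a *: g.1 + h.1, a * g.2 + h.2), (a * t + s); split; first exact: Glin.
  congr (_, _) => /=; last by ring.
  by rewrite scalerDr scalerA scalerDl addrACA.
have Gscale a g : G g -> G (a *: g.1, a * g.2).
  move=> Gg; have G0 : G (0, 0).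
    have := Glin (- 1) _ _ Gg Gg.
    by rewrite scaleN1r addNr mulN1r addNr.
  by have := Glin a _ _ Gg G0; rewrite !addr0.
move=> _ [g [t [Gg ->]]] /=.
have [t0|t0|->] := ltgtP t 0; last first.
- by rewrite mul0r scale0r !addr0; exact: Gp.
- have : sup S <= p (t^-1 *: g.1 + x0) - t^-1 * g.2.
    apply: ge_sup; first by case: Ssup.
    by move=> _ [h Gh <-]; apply: (SleU h (t^-1 *: g.1, t^-1 * g.2) Gh);
      exact: Gscale.
  rewrite -(ler_pM2l t0) mulrBr -p_homog ?(ltW t0)// scalerDr !scalerA mulrA
    mulfV ?gt_eqF//.
  by rewrite scale1r mul1r; lra.
- pose s := - t; have s0 : 0 < s by rewrite oppr_gt0.
  have : s^-1 * g.2 - p (s^-1 *: g.1 - x0) <= sup S.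
    apply: ub_le_sup; first by case: Ssup.
    by exists (s^-1 *: g.1, s^-1 * g.2) => //; exact: Gscale.
  rewrite -(ler_pM2l s0) mulrBr -p_homog ?(ltW s0)// scalerBr !scalerA mulrA
    mulfV ?gt_eqF//.
  by rewrite scale1r mul1r /s scaleNr mulNr opprK; lra.
Qed.

(** Zorn's lemma is applied to the dominated graphs that are empty or contain
    [(u, p u)]; the empty one has to be allowed as the union of the empty
    chain. *)
Lemma hahn_banach (u : V) : exists f : V -> R,
  [/\ forall a x y, f (a *: x + y) = a * f x + f y,
      forall x, f x <= p x & f u = p u].
Proof.
pose P (G : set (V * R)) := dominated_graph G /\ (G !=set0 -> G (u, p u)).
have [|A [[[Alin Ap] Au] Amax]] := @Zorn_bigcup _ P.
  move=> F FP Ftot; split; last first.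
    by move=> [g [G FG Gg]]; exists G => //; apply: (FP G FG).2; exists g.
  split; last by move=> g [G FG Gg]; exact: (FP G FG).1.2.
  move=> a g h [G FG Gg] [H FH Hh].
  have [GH|HG] := Ftot G H FG FH.
    by exists H => //; apply: (FP H FH).1.1 => //; exact: GH.
  by exists G => //; apply: (FP G FG).1.1 => //; exact: HG.
have A0 : A !=set0.
  apply/set0P/eqP => A0.
  pose L : set (V * R) := range (fun t : R => (t *: u, t * p u)).
  apply: (Amax L).
    rewrite A0; split; first by move=> ? [].
    by move=> /(_ (0, 0)); apply; exists 0; rewrite // scale0r mul0r.
  split; last by move=> _; exists 1; rewrite // scale1r mul1r.
  split.
    move=> a _ _ [t _ <-] [s _ <-] /=; exists (a * t + s) => //.
    by rewrite scalerDl scalerA mulrDl mulrA.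
  move=> _ [t _ <-] /=; have [t0|t0] := leP 0 t; first by rewrite p_homog.
  have := p_subadd (t *: u) (- t *: u).
  rewrite -scalerDl subrr scale0r p0 (@p_homog (- t)) ?oppr_ge0 ?(ltW t0)//.
  by rewrite mulNr subr_ge0.
have {}Au := Au A0.
have dom x : exists y, A (x, y).
  apply: contrapT => nx.
  have [c cP] := dominated_graph_extend x (conj Alin Ap) A0.
  set A' := [set _ | _] in cP.
  have AA' : A `<=` A'.
    by move=> [v y] Avy; exists (v, y), 0; rewrite scale0r mul0r !addr0.
  apply: (Amax A'); last by split=> // _; exact: AA'.
  split=> // A'A; apply: nx; exists c; apply: A'A.
  have A00 : A (0, 0).
    have := Alin (- 1) _ _ Au Au.
    by rewrite scaleN1r addNr mulN1r addNr.
  by exists (0, 0), 1; rewrite /= scale1r mul1r !add0r.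
have uniq x y z : A (x, y) -> A (x, z) -> y = z.
  move=> Ay Az; apply/eqP; rewrite eq_le -[y <= z]subr_le0 -[z <= y]subr_le0.
  have := Ap _ (Alin (- 1) _ _ Ay Az); have := Ap _ (Alin (- 1) _ _ Az Ay).
  rewrite /= !scaleN1r !addNr !mulN1r p0 ![- _ + _]addrC.
  by move=> -> ->.
exists (fun x => projT1 (cid (dom x))).
have fA x : A (x, projT1 (cid (dom x))) by case: cid.
split=> [a x y|x|].
- exact: (uniq (a *: x + y) _ _ (fA _) (Alin a _ _ (fA x) (fA y))).
- exact: (Ap _ (fA x)).
- exact: (uniq u _ _ (fA u) Au).
Qed.

End HahnBanach.

Section Realify.
Variables (R : realType) (V : lmodType R[i]).

(** A synonym of the type, so that restriction of scalars to the reals does not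
    compete with the complex structure. *)
Definition realified : Type := V.
HB.instance Definition _ := GRing.Zmodule.copy realified V.
Definition real_scale (t : R) (x : realified) : realified := t%:C *: (x : V).
Fact real_scaleA a b x : real_scale a (real_scale b x) = real_scale (a * b) x.
Proof. by rewrite /real_scale scalerA rmorphM. Qed.
Fact real_scale1 : left_id 1 real_scale.
Proof. by move=> x; rewrite /real_scale rmorph1 scale1r. Qed.
Fact real_scaleDr : right_distributive real_scale +%R.
Proof. by move=> a x y; rewrite /real_scale scalerDr. Qed.
Fact real_scaleDl x : {morph real_scale^~ x : a b / a + b}.
Proof. by move=> a b; rewrite /real_scale rmorphD scalerDl. Qed.
HB.instance Definition _ := GRing.Zmodule_isLmodule.Build R realified
  real_scaleA real_scale1 real_scaleDr real_scaleDl.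
End Realify.

Section NormingFunctional.
Variables (R : realType) (X : normedModType R[i]).

(** Complexify the real functional [f] of [hahn_banach] as
    [l x = f x - i f (i x)]. Rotating [x] so that [l x] becomes a nonnegative
    real, where [l] agrees with [f], bounds the modulus of [l x] by the
    norm. *)
Lemma norming_functional (u : X) : exists l : X -> R[i],
  [/\ forall (k : R[i]) x y, l (k *: x + y) = k * l x + l y,
      forall x, `|l x| <= `|x| & `|l u| = `|u|].
Proof.
have [||f [flin fle fu]] := @hahn_banach R (realified X) (@rnorm R X) _ _ u.
- exact: rnormD.
- by move=> t x t0; rewrite rnormZ rnormC ger0_norm.
have fD x y : f (x + y) = f x + f y by have := flin 1 x y;
  rewrite scale1r mul1r.
have f0 : f 0 = 0 by have := fD 0 0; rewrite addr0; lra.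
have fZ (t : R) (x : X) : f (t%:C *: x) = t * f x.
  by have := flin t x 0; rewrite !addr0 f0 addr0.
have fN (x : X) : f (- x) = - f x.
  have := fD x (- x); rewrite subrr f0; lra.
pose J : R[i] := Complex 0 1.
pose l (x : X) : R[i] := Complex (f x) (- f (J *: x)).
have lD x y : l (x + y) = l x + l y.
  by rewrite /l scalerDr !fD opprD.
have lZ k x : l (k *: x) = k * l x.
  case: k => a b.
  have kE : Complex a b = a%:C + b%:C * J by rewrite /J; simpc.
  have JJ : J * J = - 1 by rewrite /J; simpc.
  have E1 : f (Complex a b *: x) = a * f x + b * f (J *: x).
    by rewrite kE scalerDl -scalerA fD !fZ.
  have E2 : f (J *: (Complex a b *: x)) = a * f (J *: x) - b * f x.
    rewrite scalerA kE mulrDr (mulrC J a%:C) mulrCA JJ mulrN1.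
    by rewrite scalerDl -scalerA fD fZ scaleNr fN fZ.
  rewrite /l E1 E2; simpc; congr Complex; ring.
have lle x : `|l x| <= `|x|.
  have [l0|l0] := eqVneq (l x) 0; first by rewrite l0 normr0.
  pose w := `|l x| / l x.
  have w1 : `|w| = 1 by rewrite normf_div normr_id divff// normr_eq0.
  have lw : l (w *: x) = `|l x| by rewrite lZ /w divfK.
  have fw : f (w *: x) = rnorm (l x).
    by have := congr1 (@complex.Re R) lw.
  rewrite !rnormE lecR -fw (le_trans (fle _))//.
  by rewrite rnormZ /rnorm w1 mul1r.
exists l; split => //.
  by move=> k x y; rewrite lD lZ.
apply/eqP; rewrite eq_le lle /= rnormE -fu.
have : f u <= `|f u| by exact: ler_norm.
rewrite -lecR => /le_trans; apply.
exact: (normc_ge_Re (l u)).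
Qed.

End NormingFunctional.

(** * Differentials of Moebius functions of a functional *)

Section LocalDifferential.
Variables (K : numFieldType) (V W : normedModType K).

(** Differentials are local; this is needed since the iterated derivatives of
    the maps below are known explicitly only off the zero set of a
    denominator. *)
Lemma is_diff_near_eq (f g df : V -> W) (x : V) :
  (\forall y \near x, f y = g y) -> is_diff x g df -> is_diff x f df.
Proof.
move=> fg [dg <-].
have E : f \o shift x = cst (f x) + 'd g x +o_ 0 id.
  have fgx : f x = g x by exact: nbhs_singleton fg.
  apply/eqaddoP => _/posnumP[e].
  have [_ /eqaddoP /(_ e%:num)/(_ [gt0 of e%:num])] := (diff_locallyP x g).1 dg.
  have fg0 : \forall h \near (0 : V), f (h + x) = g (h + x).
    by move: fg; rewrite (near_shift 0) subr0 /=.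
  by apply: filterS2 fg0 => h /= fgh; rewrite !fctE /= fgh fgx.
have dc := diff_continuous dg.
have dE : 'd f x = 'd g x :> (V -> W) by exact: diff_unique.
by split=> //; apply/diff_locallyP; rewrite dE.
Qed.

End LocalDifferential.

Section InversePower.
Variables (K : numFieldType) (V : normedModType K).
Variables (l : V -> K) (b : K).
Hypothesis llin : linear l.
Hypothesis lcont : continuous l.

Let lM := GRing.isLinear.Build _ _ _ _ _ llin.
Let lL : {linear V -> K} := HB.pack l lM.

Lemma is_diff_functional x : is_diff x l l.
Proof.
have -> : l = lL by [].
by split; [exact: linear_differentiable | exact: diff_lin].
Qed.

Definition inv_pow m (x : V) : K := (1 - b * l x)^-1 ^+ m.

Lemma is_diff_inv_pow m x : 1 - b * l x != 0 ->
  is_diff x (inv_pow m.+1) (fun v => m.+1%:R * b * l v * inv_pow m.+2 x).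
Proof.
move=> d0; have dl := is_diff_functional x.
have d1 : is_diff x (fun y => 1 - b * l y) (fun v => - (b * l v)).
  have -> : (fun y => 1 - b * l y) = cst 1 - b *: l by [].
  by apply: is_diff_eq; apply/funext => v; rewrite !fctE sub0r.
have dV : is_diff x (fun y => (1 - b * l y)^-1)
    (fun v => (1 - b * l x) ^- 2 * (b * l v)).
  split; first by apply: differentiableV => //; exact: ex_diff.
  rewrite (diffV (@ex_diff _ _ _ _ _ _ _ d1) d0).
  apply/funext => v /=; rewrite (@diff_val _ _ _ _ _ _ _ d1).
  by rewrite /GRing.scale/= mulrNN.
have -> : inv_pow m.+1 = (fun y => (1 - b * l y)^-1) ^+ m.+1.
  by apply/funext => y; rewrite exprfctE.
apply: is_diff_eq; apply/funext => v; rewrite !fctE /inv_pow /GRing.scale /=.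
rewrite -exprVn !exprS; ring.
Qed.

Lemma is_diff_inv_powZ (W : normedModType K) (k : K) (w : W) m x :
  1 - b * l x != 0 ->
  is_diff x (fun y => (k * inv_pow m.+1 y) *: w)
    (fun v => (k * m.+1%:R * b * l v * inv_pow m.+2 x) *: w).
Proof.
move=> d0; have dm := is_diff_inv_pow m d0.
have dk : is_diff x (fun y => k * inv_pow m.+1 y)
    (fun v => k * m.+1%:R * b * l v * inv_pow m.+2 x).
  have -> : (fun y => k * inv_pow m.+1 y) = k *: inv_pow m.+1 by [].
  by apply: is_diff_eq; apply/funext => v; rewrite !fctE /GRing.scale /= !mulrA.
split; first by apply: differentiableZl; exact: ex_diff.
by rewrite diffZl ?diff_val//; exact: ex_diff.
Qed.

Lemma near_denominator x : 1 - b * l x != 0 ->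
  \forall y \near x, 1 - b * l y != 0.
Proof.
move=> d0.
have c : {for x, continuous (fun y => 1 - b * l y)}.
  apply: differentiable_continuous.
  have -> : (fun y => 1 - b * l y) = cst 1 - b *: l by [].
  by have dl := is_diff_functional x; exact: ex_diff.
exact: cvgr_neq0 c d0.
Qed.

End InversePower.

Section Contractions.
Variables (K : numFieldType) (V : normedModType K).

Lemma contraction_continuous (l : V -> K) : linear l ->
  (forall x, `|l x| <= `|x|) -> continuous l.
Proof.
move=> llin lle x; apply/cvgrPdist_lt => e e0.
near=> y.
have lB : l x - l y = l (x - y).
  by rewrite (addrC x) -(scaleN1r y) llin scaleN1r addrC.
rewrite lB; apply: (le_lt_trans (lle _)).
near: y; apply: cvgr_dist_lt => //; exact: cvg_id.
Unshelve. all: by end_near. Qed.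

Lemma linear_fun0 (l : V -> K) : linear l -> l 0 = 0.
Proof.
move=> llin; have E := llin 1 0 0; rewrite !scale1r addr0 in E.
by apply: (addIr (l 0)); rewrite add0r -E.
Qed.

Lemma row_const1_norm n : (0 < n)%N -> `|const_mx 1 : 'rV[K]_n| = 1.
Proof.
move=> n0; apply/eqP; rewrite eq_le; apply/andP; split.
  by apply: row_norm_le => // j; rewrite mxE normr1.
by have := row_entry_le (const_mx 1 : 'rV[K]_n) (Ordinal n0);
  rewrite mxE normr1.
Qed.

End Contractions.

Section Frechet.
Variables (R : realType) (X Y : normedModType R[i]).
Variables (l : X -> R[i]) (b g : R[i]) (w w0 : Y).
Hypothesis llin : linear l.
Hypothesis lcont : continuous l.

(** A Moebius function of [l] in partial fraction form: all its derivatives are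
    monomials in the inverse denominator. *)
Definition mobius_map (x : X) : Y := w0 + (g * inv_pow l b 1 x) *: w.

Lemma is_diff_mobius x : 1 - b * l x != 0 ->
  is_diff x mobius_map (fun v => (g * 1%:R * b * l v * inv_pow l b 2 x) *: w).
Proof.
move=> d0; have dg := is_diff_inv_powZ llin lcont g w 0 d0.
have -> : mobius_map = cst w0 + (fun y => (g * inv_pow l b 1 y) *: w) by [].
have := is_diffD (is_diff_cst w0 x) dg.
by rewrite add0r.
Qed.

(** By induction on the order: off the closed set where the denominator
    vanishes, the previous derivative is a multiple of a power of the inverse
    denominator. *)
Lemma frechet_deriv_mobius s z x : 1 - b * l x != 0 ->
  frechet_deriv mobius_map (nseq s.+1 z) x =
  (g * s.+1`!%:R * (b * l z) ^+ s.+1 * inv_pow l b s.+2 x) *: w.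
Proof.
elim: s x => [|s IH] x d0.
  have := @diff_val _ _ _ _ _ _ _ (is_diff_mobius d0).
  move=> E; have := congr1 (fun h : X -> Y => h z) E.
  move=> E2; apply: (etrans E2).
  by congr (_ *: _); rewrite expr1 (_ : 1`! = 1%N)// !mulrA.
set k := g * s.+1`!%:R * (b * l z) ^+ s.+1.
have D : is_diff x (frechet_deriv mobius_map (nseq s.+1 z))
   (fun v => (k * s.+2%:R * b * l v * inv_pow l b s.+3 x) *: w).
  apply: is_diff_near_eq (is_diff_inv_powZ llin lcont k w s.+1 d0).
  by apply: filterS (near_denominator llin lcont d0) => y /IH.
have E := @diff_val _ _ _ _ _ _ _ D.
have E2 := congr1 (fun h : X -> Y => h z) E.
apply: (etrans E2); congr (_ *: _); rewrite /k.
rewrite [s.+2`!]factS natrM [(b * l z) ^+ s.+2]exprS.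
move: (inv_pow _ _ _ _) (s.+1`!%:R) (s.+2%:R) ((b * l z) ^+ s.+1) (l z) =>
  p q r t u.
ring.
Qed.

Lemma taylor_term_mobius s z :
  taylor_term mobius_map s.+1 z = (g * (b * l z) ^+ s.+1) *: w.
Proof.
have l0 := linear_fun0 llin.
rewrite /taylor_term frechet_deriv_mobius;
  last by rewrite l0 mulr0 subr0 oner_neq0.
rewrite scalerA /inv_pow l0 mulr0 subr0 invr1 expr1n mulr1.
by congr (_ *: _); rewrite [g * _]mulrC -!mulrA mulKf// pnatr_eq0 -lt0n
  fact_gt0.
Qed.

End Frechet.

(** * The extremal map *)

Section Disc.
Variable C : numClosedFieldType.

(** The identity behind it is [|1 - b t|^2 - |b - t|^2 = (1 - b^2) (1 - |t|^2)]
    for real [b]. *)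
Lemma blaschke_lt1 (b t : C) : 0 < b -> b < 1 -> `|t| < 1 ->
  `|(b - t) / (1 - b * t)| < 1.
Proof.
move=> b0 b1 t1.
have bC : b^* = b by apply: conj_Creal; rewrite gtr0_real.
have d0 : 1 - b * t != 0.
  rewrite subr_eq0 eq_sym; apply: contraTneq
    (ltr_pM (ltW b0) (normr_ge0 t) b1 t1) => E.
  by rewrite -[b]gtr0_norm// -normrM E normr1 mulr1 ltxx.
rewrite normf_div ltr_pdivrMr ?normr_gt0// mul1r.
rewrite -(@ltr_pXn2r _ 2) ?nnegrE// !normCK !rmorphB rmorphM rmorph1 /= bC.
rewrite -subr_gt0.
have -> : (1 - b * t) * (1 - b * t^*) - (b - t) * (b - t^*) =
  (1 - b ^+ 2) * (1 - t * t^*) by ring.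
by rewrite -normCK mulr_gt0// subr_gt0 expr_lt1// ltW.
Qed.

End Disc.

Section ExtremalMap.
Variables (R : realType) (X : completeNormedModType R[i]) (n : nat).
Hypothesis n_gt0 : (0 < n)%N.
Variables (l : X -> R[i]) (alpha : R).
Hypotheses (llin : linear l) (lle : forall x, `|l x| <= `|x|).
Hypotheses (alpha_gt0 : 0 < alpha) (alpha_lt1 : alpha < 1).

Let lcont : continuous l := contraction_continuous llin lle.
Let b : R[i] := alpha%:C.
Let b_gt0 : 0 < b. Proof. by rewrite -[0]/(0%:C) ltcR. Qed.
Let b_lt1 : b < 1. Proof. by rewrite -[1]/(1%:C) ltcR. Qed.
Let b_neq0 : b != 0. Proof. by rewrite gt_eqF. Qed.
Let e : 'rV[R[i]]_n := const_mx 1.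
Let e_norm : `|e| = 1. Proof. exact: row_const1_norm. Qed.

Definition extremal_center : 'rV[R[i]]_n := b *: e.

(** The map [x |-> (b - l x) / (1 - b l x)] in each coordinate
    ([extremal_mapE]), where [b] is [alpha], split into partial fractions. *)
Definition extremal_map : X -> 'rV[R[i]]_n :=
  mobius_map l b (- ((1 - b ^+ 2) / b)) e (b^-1 *: e).

Lemma ball_functional x : unit_ball X x -> `|b * l x| < 1.
Proof.
move=> x1; rewrite normrM (gtr0_norm b_gt0).
apply: le_lt_trans (x1 : `|x| < 1).
rewrite (le_trans _ (lle x))// ler_piMl// ltW//.
Qed.

Lemma ball_denominator x : unit_ball X x -> 1 - b * l x != 0.
Proof.
move=> /ball_functional; rewrite subr_eq0 eq_sym; apply: contraTneq => ->.
by rewrite normr1 ltxx.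
Qed.

Lemma extremal_mapE x : unit_ball X x ->
  extremal_map x = ((b - l x) / (1 - b * l x)) *: e.
Proof.
move=> /ball_denominator d0; rewrite /extremal_map /mobius_map /inv_pow expr1.
rewrite -scalerDl; congr (_ *: _).
move: (l x) d0 b_neq0 => t; move: b => c d0 c0.
by field; rewrite c0 d0.
Qed.

Lemma extremal_taylor s x : taylor_term extremal_map s.+1 x =
  (- ((1 - b ^+ 2) / b) * (b * l x) ^+ s.+1) *: e.
Proof. exact: taylor_term_mobius. Qed.

Lemma extremal_admissible : admissible extremal_center extremal_map.
Proof.
split.
- apply: subset_closure => j; rewrite mxE [X in _ * X]mxE mulr1.
  by rewrite (gtr0_norm b_gt0).
- move=> x /ball_denominator d0.
  have D := is_diff_mobius (- ((1 - b ^+ 2) / b)) e (b^-1 *: e) llin lcont d0.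
  exact: (@ex_diff _ _ _ _ _ _ _ D).
- move=> x x1; apply: subset_closure => j;
  rewrite extremal_mapE// mxE [X in _ * X]mxE mulr1.
  by apply: blaschke_lt1 => //; exact: le_lt_trans (lle x) x1.
- move=> x x1; apply/cvgrPdist_lt => d d_gt0.
  have bx := ball_functional x1; have d0 := ball_denominator x1.
  pose K := `|(1 - b ^+ 2) / b| / `|1 - b * l x|.
  have K0 : 0 <= K by rewrite divr_ge0.
  have d2 : 0 < d / 2 by rewrite divr_gt0.
  have [N HN] := complex_geometric_small K0 (normr_ge0 (b * l x)) bx d2.
  exists N => // m /= Nm.
  have -> : extremal_map x - (extremal_center + \sum_(1 <= s < m.+1)
    taylor_term extremal_map s x) =
     (- ((1 - b ^+ 2) / b) * (b * l x) ^+ m.+1 / (1 - b * l x)) *: e.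
    rewrite big_add1 /= big_mkord; under eq_bigr do rewrite extremal_taylor.
    rewrite -scaler_suml -scalerDl extremal_mapE// -scalerBl; congr (_ *: _).
    rewrite -mulr_sumr; under eq_bigr do rewrite exprS.
    rewrite -mulr_sumr.
    have S : (1 - b * l x) * \sum_(i < m) (b * l x) ^+ i = 1 - (b * l x) ^+ m.
      by rewrite -opprB mulNr -subrX1 opprB.
    have -> : \sum_(i < m) (b * l x) ^+ i = (1 - (b * l x) ^+ m) /
      (1 - b * l x).
      by rewrite -S mulrAC mulfV// mul1r.
    rewrite [(b * l x) ^+ m.+1]exprS; move: ((b * l x) ^+ m) => p.
    move: (l x) d0 b_neq0 => t; move: b => c d0 c0.
    by field; rewrite c0 d0.
  have -> : `|(- ((1 - b ^+ 2) / b) * (b * l x) ^+ m.+1 / (1 - b * l x)) *: e| =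
    K * `|b * l x| ^+ m.+1.
    by rewrite normrZ e_norm mulr1 normf_div normrM normrN normrX /K mulrAC.
  apply: (@le_lt_trans _ _ (d / 2)); first by apply: HN; exact: leqW.
  by rewrite ltr_pdivrMr// mulr_natr mulr2n ltrDl.
- move=> j; rewrite /extremal_center mxE [X in _ * X]mxE normrM normr1 mulr1.
  by rewrite normrZ e_norm mulr1.
Qed.

Lemma extremal_center_norm : rnorm extremal_center = alpha.
Proof. by apply: complexI; rewrite -rnormE normrZ e_norm mulr1 gtr0_norm. Qed.

Lemma extremal_taylor_norm s x : rnorm (taylor_term extremal_map s.+1 x) =
  (1 - alpha ^+ 2) * alpha ^+ s * rnorm (l x) ^+ s.+1.
Proof.
apply: complexI; rewrite -rnormE extremal_taylor normrZ e_norm mulr1.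
rewrite normrM normrN normf_div normrX [`|b * l x|]normrM.
rewrite !rmorphM !rmorphXn rmorphB rmorph1 rmorphXn /= -rnormE.
rewrite (gtr0_norm b_gt0) -!/b ger0_norm; last first.
  by rewrite subr_ge0 exprn_ile1// ltW.
rewrite exprMn [b ^+ s.+1]exprS; move: (_ ^+ s.+1) => p; move: (b ^+ s) => q.
by field.
Qed.

(** In the inner sums [alpha ^+ M] bounds from below all the powers of [alpha]
    that occur, and the outer sum is cut after [M] terms. *)
Lemma extremal_majorant_ge (z : X) M : `|l z| = `|z| -> rnorm z <= 1 ->
  (forall K, (alpha * log_psum K (rnorm z))%:E +
    ((1 - alpha ^+ 2) * alpha ^+ M * cesaro_psum M.+1 (rnorm z))%:E <=
  cesaro_majorant extremal_center extremal_map z)%E.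
Proof.
move=> lz r1 K; rewrite /cesaro_majorant extremal_center_norm.
have r0 := rnorm_ge0 z.
have a2 : 0 <= 1 - alpha ^+ 2 by rewrite subr_ge0 exprn_ile1// ltW.
have P_E s : rnorm (taylor_term extremal_map s.+1 z) =
    (1 - alpha ^+ 2) * alpha ^+ s * rnorm z ^+ s.+1.
  by rewrite extremal_taylor_norm /rnorm lz.
move: (rnorm z) r0 r1 P_E => r r0 r1 P_E.
apply: leeD.
  rewrite (_ : alpha * log_psum K r = \sum_(0 <= k < K)
    alpha * r ^+ k / k.+1%:R).
    by apply: psum_le_nneseries => k; rewrite !mulr_ge0 ?exprn_ge0// ltW.
  by rewrite /log_psum mulr_sumr big_mkord; apply: eq_bigr => k _;
    rewrite mulrA.
apply: (@le_trans _ _ (\sum_(1 <= N < M.+1) (N.+1%:R^-1 * \sum_(1 <= k < N.+1)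
    r ^+ k.-1 * rnorm (taylor_term extremal_map (N - k + 1)%N z)))%:E);
      last first.
  apply: psum_le_nneseries => N; rewrite mulr_ge0// sumr_ge0// => k _.
  by rewrite mulr_ge0 ?exprn_ge0// rnorm_ge0.
rewrite lee_fin /cesaro_psum mulr_sumr big_nat [leRHS]big_nat.
apply: ler_sum => N /andP[N1 NM].
rewrite [leLHS](_ : _ = N.+1%:R^-1 *
  \sum_(1 <= k < N.+1) (1 - alpha ^+ 2) * alpha ^+ M * r ^+ N); last first.
  by rewrite sumr_const_nat subn1 /=; ring.
rewrite ler_wpM2l// big_nat [leRHS]big_nat; apply: ler_sum => k /andP[k1 kN].
rewrite addn1 P_E mulrCA -exprD addnS -addSn prednK// subnKC//.
rewrite ler_wpM2r ?exprn_ge0// ler_wpM2l// ler_wiXn2l// ?(ltW alpha_gt0)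
  ?(ltW alpha_lt1)//.
by rewrite (leq_trans (leq_subr _ _)).
Qed.

End ExtremalMap.

Section Sharpness.
Variable R : realType.

(** After division by [1 - alpha] the inequality reads
    [L < (1 + alpha) alpha^M T], which tends to [L < 2 T] as [alpha] tends to
    1. *)
Lemma exists_extremal_parameter (L T : R) M : 0 < L -> L < 2 * T ->
  exists alpha : R, [/\ 0 < alpha, alpha < 1 &
    L < alpha * L + (1 - alpha ^+ 2) * alpha ^+ M * T].
Proof.
move=> L0 LT; have T0 : 0 < T by lra.
have c0 : 0 < 1 + 2 * M%:R :> R by rewrite ltr_wpDr// mulr_ge0.
(* For [alpha = 1 - d], [(1 + alpha) alpha^M >= 2 - (1 + 2 M) d]; this choice
   spends half of the available gap [2 T - L]. *)
pose d := (2 * T - L) / (2 * (1 + 2 * M%:R) * T).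
have D0 : 0 < 2 * (1 + 2 * M%:R) * T by rewrite !mulr_gt0.
have d0 : 0 < d by rewrite divr_gt0// subr_gt0.
have d1 : d < 1.
  rewrite ltr_pdivrMr// mul1r.
  have : 0 <= M%:R * T by rewrite mulr_ge0 ?ler0n// ltW.
  lra.
exists (1 - d); split; [by rewrite subr_gt0 | by rewrite gtrBl |].
rewrite -subr_gt0.
have -> : (1 - d) * L + (1 - (1 - d) ^+ 2) * (1 - d) ^+ M * T - L =
  d * ((2 - d) * (1 - d) ^+ M * T - L) by ring.
rewrite mulr_gt0// subr_gt0.
apply: (@lt_le_trans _ _ ((2 - (1 + 2 * M%:R) * d) * T)).
  have -> : (2 - (1 + 2 * M%:R) * d) * T = 2 * T - (1 + 2 * M%:R) * T * d
    by ring.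
  have -> : (1 + 2 * M%:R) * T * d = (2 * T - L) / 2.
    by rewrite /d; field; rewrite !gt_eqF.
  lra.
rewrite ler_wpM2r ?(ltW T0)//.
apply: (@le_trans _ _ ((2 - d) * (1 - M%:R * d))).
  rewrite -subr_ge0.
  have -> : (2 - d) * (1 - M%:R * d) - (2 - (1 + 2 * M%:R) * d) = M%:R * d ^+ 2
    by ring.
  by rewrite mulr_ge0 ?ler0n// exprn_ge0// ltW.
rewrite ler_wpM2l//; first lra.
by rewrite bernoulli_ineq// ltW.
Qed.

Variables (X : completeNormedModType R[i]) (n : nat).
Hypothesis n_gt0 : (0 < n)%N.
Hypothesis X_neq0 : exists x : X, x != 0.

Lemma exists_norm_eq (r : R) : 0 <= r -> exists z : X, rnorm z = r.
Proof.
move=> r0; have [x x0] := X_neq0.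
have x0' : rnorm x != 0.
  by apply: contra x0 => /eqP x0; rewrite -normr_eq0 rnormE x0.
exists ((r / rnorm x)%:C *: x).
by rewrite rnormZ rnormC ger0_norm ?divr_ge0 ?rnorm_ge0// divfK.
Qed.

(** Above the critical radius the partial sums of [sum N r^N / (N+1)]
    eventually exceed [L / 2], as they tend to [1 / (1 - r) - L]. *)
Lemma cesaro_majorant_gt (r : R) : 0 < r -> r < 1 ->
  3 * cesaro_bound r < 2 / (1 - r) ->
  exists (a : 'rV[R[i]]_n) (F : X -> 'rV[R[i]]_n), admissible a F /\
    exists2 z : X, rnorm z = r &
      ~ (cesaro_majorant a F z <= (cesaro_bound r)%:E)%E.
Proof.
move=> r0 r1 crit.
set L := cesaro_bound r in crit *; pose G := (1 - r)^-1.
have G0 : 0 < G by rewrite invr_gt0 subr_gt0.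
have L0 : 0 < L.
  have /andP[+ _] := cesaro_bound_psum 1 (ltW r0) r1.
  by rewrite /log_psum big_ord1 expr0 divr1 subr_ge0; apply: lt_le_trans.
have gap : 0 < 2 * G - 3 * L by rewrite subr_gt0.
have G2 : 0 <= 2 * G by rewrite mulr_ge0// ltW.
have [M HM] := geometric_small_real G2 (ltW r0) r1 gap.
pose T := cesaro_psum M.+1 r.
have LT : L < 2 * T.
  have /andP[+ _] := cesaro_psum_bounds M (ltW r0) r1; rewrite -/T -/L.
  rewrite mulrBl mul1r -/G; have := HM M.+1 (leqnSn M).
  rewrite -/G; lra.
have [alpha [a0 a1 big]] := exists_extremal_parameter M L0 LT.
have [z zr] := exists_norm_eq (ltW r0).
have [l [llin lle lz]] := norming_functional z.
have Fadm := extremal_admissible n_gt0 llin lle a0 a1.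
exists (extremal_center n alpha), (extremal_map n l alpha); split => //.
exists z => // majorant_le.
have r1' : rnorm z <= 1 by rewrite zr ltW.
have low K := le_trans (extremal_majorant_ge n_gt0 llin lle a0 a1 M lz r1' K)
  majorant_le.
pose g := alpha * L + (1 - alpha ^+ 2) * alpha ^+ M * T - L.
have g0 : 0 < g by rewrite subr_gt0.
have aG0 : 0 <= alpha * G by rewrite mulr_ge0// ltW.
have [K HK] := geometric_small_real aG0 (ltW r0) r1 g0.
have := low K; rewrite zr -EFinD lee_fin -/T -/L.
have /andP[_] := cesaro_bound_psum K (ltW r0) r1; rewrite -/L -/G => h.
have := ler_wpM2l (ltW a0) h; rewrite mulrBr.
have := HK K (leqnn K); rewrite /g; lra.
Qed.

End Sharpness.

Theorem theorem2p1 (R : realType) (X : completeNormedModType R[i])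
    (X_neq0 : exists x : X, x != 0) (n : nat) (n_ge1 : (1 <= n)%N)
    (rho : R) (rho_gt0 : 0 < rho) (rho_lt1 : rho < 1)
    (rho_root : 3 * (1 - rho) * ln ((1 - rho)^-1) - 2 * rho = 0) :
  (forall (a : 'rV[R[i]]_n) (F : X -> 'rV[R[i]]_n), admissible a F ->
     forall z : X, unit_ball X z -> rnorm z <= rho ->
       (cesaro_majorant a F z <= (cesaro_bound (rnorm z))%:E)%E) /\
  (forall rho' : R, rho < rho' -> rho' < 1 ->
     exists (a : 'rV[R[i]]_n) (F : X -> 'rV[R[i]]_n), admissible a F /\
       exists z : X, [/\ unit_ball X z, rnorm z <= rho' &
         ~ (cesaro_majorant a F z <= (cesaro_bound (rnorm z))%:E)%E]).
Proof.
split=> [a F Fadm z _ zrho|rho' rho_lt rho'_lt1].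
  exact: cesaro_majorant_le n_ge1 _ rho_gt0 rho_lt1 rho_root _ _ _ Fadm zrho.
have crit := critical_radius_above rho_gt0 rho_lt1 rho_root rho_lt rho'_lt1.
have [a [F [Fadm [z zr bad]]]] :=
  cesaro_majorant_gt n_ge1 X_neq0 (lt_trans rho_gt0 rho_lt) rho'_lt1 crit.
exists a, F; split=> //; exists z; rewrite zr; split=> //.
by rewrite /unit_ball /= rnormE zr -[1]/(1%:C) ltcR.
Qed.
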